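(* The subsystem $H_3$ (written as the switched system $\dot\theta^{ik}_j=g_j(x_{ik})$ for $(k,j)\notin\sigma_i(t)$ and $\dot\theta^{ik}_j=0$ for $(k,j)\in\sigma_i(t)$) is passive with port input $\dot u_{H_3}$ and port output $\dot y_{H_3}$ for each pair of switching time instances $(\tau^+_{\sigma_i},\tau^-_{\sigma_i})$, $\tau^-_{\sigma_i}<\tau^+_{\sigma_i}$, such that $\sigma_i(\tau^+_{\sigma_i})=\sigma_i(\tau^-_{\sigma_i})=\sigma_i$ and $\sigma_i(\tau')\neq\sigma_i$ for $\tau^-_{\sigma_i}<\tau'<\tau^+_{\sigma_i}$.
   Context: There are $n$ agents $i\in\mathcal N=\{1,\dots,n\}$ with variables $x_i=[x_{i1},\dots,x_{il}]^T\in\mathbb R^l$, $x=[x_1^T,\dots,x_n^T]^T$, and convex (differentiable) constraint functions $g_j:\mathbb R\to\mathbb R$, with constraints $g_j(x_{ik})\le0$ for $j=1,\dots,m_g^{ik}$, $k=1,\dots,l$. The $\theta^{ik}_j\ge0$ are the corresponding multipliers. For scalars, $[a]^+_b:=a$ if $b>0$ or $a>0$, and $[a]^+_b:=0$ otherwise. Subsystem $H_3$: $\dot\theta^{ik}_j=[g_j(x_{ik})]^+_{\theta^{ik}_j}$ for all $i,k,j$, with input $u_{H_3}=x\in\mathbb R^{ln}$ and output $y_{H_3}\in\mathbb R^{ln}$ whose $(i,k)$ entry is $\sum_{j=1}^{m_g^{ik}}\theta^{ik}_j\nabla g_j(x_{ik})$. Switching signal: $\sigma_i(t)=\{(k,j):\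 \theta^{ik}_j(t)=0,\ g_j(x_{ik}(t))\le0\}$ is the set of constraint indices of agent $i$ for which the projection is active at time $t$. The symbol $\sigma_i$ without argument denotes a fixed value of this signal. Storage function associated with $H_3$: $V_{H_3}(\theta)=\frac12\sum_{i=1}^n\sum_{k=1}^l\sum_{j:(k,j)\notin\sigma_i(t)}(\dot\theta^{ik}_j)^2$. Passivity for a pair of switching times means that the increment of the storage function between $\tau^-_{\sigma_i}$ and $\tau^+_{\sigma_i}$ is at most the supplied quantity: $V_{H_3}(\tau^+_{\sigma_i})-V_{H_3}(\tau^-_{\sigma_i})\le\int_{\tau^-_{\sigma_i}}^{\tau^+_{\sigma_i}}\dot y_{H_3}^T\dot u_{H_3}\,dt$. *)

(* Defs.v *)
From HB Require Import structures.
From mathcomp Require Import all_boot all_order all_algebra.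
From mathcomp Require Import all_classical all_reals all_analysis.
Import Order.TTheory GRing.Theory Num.Theory.
Import numFieldNormedType.Exports.

Set Implicit Arguments.
Unset Strict Implicit.
Unset Printing Implicit Defensive.

Local Open Scope classical_set_scope.
Local Open Scope ring_scope.

(** Conventions.  Agents are [i : 'I_n], components [k : 'I_l], and the
    constraints on [x_ik] are [g j] with [j : 'I_(m i k)], so indices are shifted
    by one.  A stacked vector of R^(l n) is an ['M[R]_(n, l)] with entry [(i, k)].
    Time is [0, +oo); values of signals at negative times are irrelevant. *)

Section Signals.
Variable R : realType.
Local Notation mu := (@lebesgue_measure R).

Definition ae_derivative (f df : R -> R) : Prop :=
  measurable_fun (`[(0 : R), +oo[ : set R) df /\
  {ae mu, forall t : R, 0 < t -> is_derive t (1 : R) f (df t)}.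

(** [f] is locally absolutely continuous on [0, +oo), with derivative [df]. *)
Definition ac_derivative (f df : R -> R) : Prop :=
  [/\ ae_derivative f df,
      forall T : R, 0 <= T -> mu.-integrable `[0, T] (EFin \o df) &
      forall s t : R, 0 <= s <= t ->
        f t - f s = Rintegral mu `[s, t] df].

(** The increment of the storage [V] over [[t0, t1]] is at most the quantity
    supplied through the port [(u, y)].  The integral is extended-real valued:
    the supplied quantity may be [+oo]. *)
Definition passive_between (n l : nat) (V : R -> R) (u y : R -> 'M[R]_(n, l))
    (t0 t1 : R) : Prop :=
  ((V t1 - V t0)%:E <=
   \int[mu]_(t in `[t0, t1]) (\sum_(i < n) \sum_(k < l) y t i k * u t i k)%:E)%E.

End Signals.

(** The projection [a]^+_b. *)
Definition proj_pos (R : realType) (a b : R) : R :=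
  if (0 < b) || (0 < a) then a else 0.

Section H3.
Variables (R : realType) (n l : nat) (m : 'I_n -> 'I_l -> nat).
Variable g : nat -> R -> R.
Implicit Types (x : R -> 'M[R]_(n, l)).
Implicit Types (theta dtheta : forall (i : 'I_n) (k : 'I_l), 'I_(m i k) -> R -> R).

Definition constraint (i : 'I_n) : finType := {k : 'I_l & 'I_(m i k)}.

Definition cstr (i : 'I_n) (k : 'I_l) (j : 'I_(m i k)) : constraint i :=
  @Tagged _ k (fun k0 : 'I_l => 'I_(m i k0)) j.

Definition switching_signal x theta (i : 'I_n) (t : R) : {set constraint i} :=
  [set c : constraint i | (theta i (tag c) (tagged c) t == 0) &&
                          (g (tagged c) (x t i (tag c)) <= 0)]%SET.

(** Carathéodory solutions of the switched form of H3 with input [x].  The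
    multiplier rate [dtheta] is the right-hand side at every time, and the
    derivative of [theta] at almost every time ([theta] may have a kink when it
    reaches [0]). *)
Definition H3_trajectory x theta dtheta : Prop :=
  forall (i : 'I_n) (k : 'I_l) (j : 'I_(m i k)),
    [/\ forall t : R, 0 <= t -> 0 <= theta i k j t,
        ac_derivative (theta i k j) (dtheta i k j) &
        forall t : R, 0 <= t -> dtheta i k j t =
          if cstr j \in switching_signal x theta i t then 0
          else g j (x t i k)].

Definition H3_output x theta (t : R) : 'M[R]_(n, l) :=
  \matrix_(i < n, k < l)
    \sum_(j < m i k) theta i k j t * derive1 (g j) (x t i k).

Definition H3_storage x theta dtheta (t : R) : R :=
  2^-1 * \sum_(i < n) \sum_(k < l)
    \sum_(j < m i k | cstr j \notin switching_signal x theta i t)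
      dtheta i k j t ^+ 2.

(** The switched form agrees with the projected form of H3. *)
Lemma switched_proj_pos x theta (i : 'I_n) (k : 'I_l) (j : 'I_(m i k)) (t : R) :
  0 <= theta i k j t ->
  (if cstr j \in switching_signal x theta i t then 0 else g j (x t i k)) =
  proj_pos (g j (x t i k)) (theta i k j t).
Proof.
move=> th0; rewrite inE /= /proj_pos [0 < theta _ _ _ _]lt0r th0 andbT.
by rewrite ltNge; case: eqP => //= _; case: (_ <= 0).
Qed.

End H3.

(* Main.v *)
(** Along one constraint write h = g_j(x_ik) and let phi be the rate of its
    multiplier theta, so that phi = max(h,0) + min(h,0) 1_{theta > 0}.  Convexity
    makes g_j' monotone, so multiplying the difference quotients of
    y = sum_j theta_j g_j'(x) and of x gives dy dx >= sum_j phi_j h_j' almost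
    everywhere.  It remains to see that phi^2 / 2 increases by at most the integral
    of phi h'.  Replace the indicator of theta > 0 by
    psi_n(theta) = 1 - exp(- n theta): then
    max(h,0)^2 / 2 + min(h,0)^2 / 2 psi_n(theta) is absolutely continuous, and since
    theta decreases whenever it moves while h < 0, its derivative is at most
    (max(h,0) + min(h,0) psi_n(theta)) h'.  Integrate and let n tend to infinity by
    dominated convergence; the downward jumps of the storage when a multiplier hits
    zero are absorbed in this limit. *)

Require Import Defs.
From HB Require Import structures.
From mathcomp Require Import all_boot all_order all_algebra.
From mathcomp Require Import all_classical all_reals all_analysis.
From mathcomp Require Import measurable_realfun.
From mathcomp Require Import ring lra.
Import Order.TTheory GRing.Theory Num.Theory.
Import numFieldNormedType.Exports.

Set Implicit Arguments.
Unset Strict Implicit.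
Unset Printing Implicit Defensive.

Local Open Scope classical_set_scope.
Local Open Scope ring_scope.

(** * Calculus of absolutely continuous functions on a segment *)

Section IndefiniteIntegral.
Context {R : realType}.
Local Notation mu := (@lebesgue_measure R).
Implicit Types (a b s t : R) (f df G dG : R -> R).

(** Absolute continuity on [a, b] in integral form. The chain and product rules below are proved
    directly for this form, with no appeal to pointwise derivatives of [f]. *)
Definition indefinite_integral a b f df :=
  mu.-integrable `[a, b] (EFin \o df) /\
  forall s t, a <= s -> s <= t -> t <= b ->
    f t - f s = Rintegral mu `[s, t] df.

Lemma integrable_subitv a b s t df : a <= s -> t <= b ->
  mu.-integrable `[a, b] (EFin \o df) -> mu.-integrable `[s, t] (EFin \o df).
Proof.
move=> as_ tb; apply: integrableS => //.
by apply: subset_itv; rewrite bnd_simp.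
Qed.

Lemma indefinite_integralW a b s t f df : a <= s -> t <= b ->
  indefinite_integral a b f df -> indefinite_integral s t f df.
Proof.
move=> as_ tb [idf fE]; split; first exact: integrable_subitv idf.
by move=> u v su uv vt; apply: fE => //; [exact: le_trans su | exact: le_trans tb].
Qed.

Lemma Rintegral_subitv a b s t df : a <= s -> s <= t -> t <= b ->
  mu.-integrable `[a, b] (EFin \o df) ->
  Rintegral mu `[a, t] df - Rintegral mu `[a, s] df = Rintegral mu `[s, t] df.
Proof.
move=> as_ st tb idf; rewrite Rintegral_itvB ?bnd_simp//; last first.
  by apply: integrable_subitv idf.
rewrite Rintegral_itv_obnd_cbnd//; apply: integrableS idf => //.
by apply: subset_itv; rewrite bnd_simp.
Qed.

Lemma indefinite_integral_continuous a b f df : a <= b ->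
  indefinite_integral a b f df -> {within `[a, b], continuous f}.
Proof.
move=> ab [idf fE].
have cF := parameterized_integral_continuous ab idf.
apply: (@subspace_eq_continuous _ _ _
  (cst (f a) \+ (fun x => parameterized_integral mu a x df))).
  move=> t; rewrite inE/= in_itv/= => /andP[at_ tb].
  by rewrite /parameterized_integral -(fE _ _ (lexx a) at_ tb) addrC subrK.
by move=> t; apply: cvgD; [exact: cvg_cst|exact: cF].
Qed.

Lemma integrable_EFinD a b f g :
  mu.-integrable `[a, b] (EFin \o f) -> mu.-integrable `[a, b] (EFin \o g) ->
  mu.-integrable `[a, b] (EFin \o (f \+ g)).
Proof. by move=> idf idg; have := integrableD _ idf idg; exact. Qed.

Lemma integrable_EFinZ a b c f :
  mu.-integrable `[a, b] (EFin \o f) ->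
  mu.-integrable `[a, b] (EFin \o (fun t => c * f t)).
Proof. by move=> idf; have := integrableZl _ c idf; exact. Qed.

Lemma indefinite_integralD a b f df g dg :
  indefinite_integral a b f df -> indefinite_integral a b g dg ->
  indefinite_integral a b (f \+ g) (df \+ dg).
Proof.
move=> [idf fE] [idg gE]; split; first exact: integrable_EFinD.
move=> s t as_ st tb; rewrite RintegralD//; last 2 first.
- exact: integrable_subitv idf.
- exact: integrable_subitv idg.
by rewrite -(fE _ _ as_ st tb) -(gE _ _ as_ st tb)/= opprD addrACA.
Qed.

Lemma indefinite_integralZ a b (c : R) f df :
  indefinite_integral a b f df ->
  indefinite_integral a b (fun t => c * f t) (fun t => c * df t).
Proof.
move=> [idf fE]; split; first exact: integrable_EFinZ.
move=> s t as_ st tb; rewrite RintegralZl//; last exact: integrable_subitv idf.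
by rewrite -(fE _ _ as_ st tb) mulrBr.
Qed.

Lemma integrableM_continuous a b (h : R -> R) df :
  {within `[a, b], continuous h} -> mu.-integrable `[a, b] (EFin \o df) ->
  mu.-integrable `[a, b] (EFin \o (fun t => h t * df t)).
Proof.
move=> ch idf.
rewrite (_ : _ \o _ = (EFin \o h) \* (EFin \o df))%E//.
apply: integrableMr => //.
  by apply: subspace_continuous_measurable_fun.
have /compact_bounded := continuous_compact ch (@segment_compact _ a b).
rewrite /bounded_set /bounded_near => -[M [Mr MP]].
exists M; split => // N MN x abx; apply: (MP N MN) => /=.
by exists x.
Qed.

(** Supremum argument: let c be the supremum of the t with F t <= F a. The local hypothesis at c
    compares a point of this set just below c with one just above, so c cannot stop before b. *)
Lemma le_locally_nonincreasing a b (F : R -> R) : a <= b ->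
  (forall z, a <= z <= b -> exists2 d, 0 < d & forall s t,
    a <= s -> s <= t -> t <= b -> `|z - s| < d -> `|z - t| < d -> F t <= F s) ->
  F b <= F a.
Proof.
move=> ab loc.
pose S := [set t | a <= t <= b /\ F t <= F a].
have Sa : S a by rewrite /S/= lexx ab.
have Sb : has_sup S.
  by split; [exists a|exists b => t [/andP[]]].
have Sub : ubound S b by move=> t [/andP[]].
pose c := sup S.
have ac : a <= c by exact: sup_upper_bound.
have cb : c <= b by apply: sup_le_ub => //; exists a.
have [|d d0 dP] := loc c; first by rewrite ac cb.
have [u Su cu] := sup_adherent d0 Sb.
have uc : u <= c by apply: sup_upper_bound.
have [/andP[au ub] Fu] := Su.
(* [v] lies in the ball around [c] and beyond [c] unless [c = b]; membership of [v] in [S] then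
   forces [c = b]. *)
pose v := Num.min b (c + d / 2).
have cv : c <= v by rewrite le_min cb lerDl ltW// divr_gt0.
have Fv : F v <= F a.
  apply: le_trans Fu; apply: dP => //.
  - exact: le_trans cv.
  - by rewrite ge_min lexx.
  - by rewrite ger0_norm ?subr_ge0// ltrBlDr addrC -ltrBlDr.
  - rewrite ler0_norm ?subr_le0// opprB ltrBlDr gt_min; apply/orP; right.
    by rewrite addrC ltrD2r ltr_pdivrMr// ltr_pMr// ltr1n.
have vc : v <= c.
  apply: sup_upper_bound => //; split => //.
  by rewrite (le_trans ac cv)/= ge_min lexx.
move: vc; rewrite /v minEle; case: ifP => [bcd bc|_].
  by rewrite (_ : b = v) // /v minEle bcd.
by rewrite gerDl leNgt divr_gt0.
Qed.

(** The mean value theorem with unordered end points, since it is applied to values f s and f t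
    whose order is unknown; the intermediate point stays in the ball because the ball is convex. *)
Lemma mean_value_ball G dG (z d : R) (x y : R) :
  (forall w, is_derive w (1 : R) G (dG w)) ->
  `|z - x| < d -> `|z - y| < d ->
  exists2 c, `|z - c| < d & G y - G x = dG c * (y - x).
Proof.
move=> GdG; wlog xy : x y / x <= y => [hw|] zx zy.
  have [xy|/ltW yx] := leP x y; first exact: hw xy zx zy.
  have [c zc cE] := hw _ _ yx zy zx; exists c => //.
  by rewrite -opprB cE -mulrN opprB.
have cG : {within `[x, y], continuous G}.
  by apply: derivable_within_continuous => w _; have [] := GdG w.
have [c cxy cE] := MVT_segment xy (fun w _ => GdG w) cG.
exists c => //; move: cxy; rewrite in_itv/= => /andP[xc cy].
move: zx zy; rewrite !ltr_distlC => /andP[zx xz] /andP[zy yz].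
by rewrite (lt_le_trans zx xc) (le_lt_trans cy yz).
Qed.

(* Local comparison: near z the mean value theorem replaces dG (f u) by a constant
   up to e, so G \o f minus the candidate integral minus e times the integral of
   |df| is locally nonincreasing. *)
Lemma indefinite_integral_comp a b G dG f df : a <= b ->
  (forall z, is_derive z (1 : R) G (dG z)) -> continuous dG ->
  indefinite_integral a b f df ->
  indefinite_integral a b (G \o f) (fun t => dG (f t) * df t).
Proof.
(* One inequality suffices: applied to [- G] it yields the reverse one. *)
have half : forall a b G dG f df, a <= b ->
    (forall z, is_derive z (1 : R) G (dG z)) -> continuous dG ->
    indefinite_integral a b f df ->
    G (f b) - G (f a) <= Rintegral mu `[a, b] (fun t => dG (f t) * df t).
  move=> {}a {}b {}G {}dG {}f {}df ab GdG cdG fdf.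
  have cf := indefinite_integral_continuous ab fdf.
  have [idf fE] := fdf.
  have ig : mu.-integrable `[a, b] (EFin \o (fun t => dG (f t) * df t)).
    apply: integrableM_continuous => //.
    by apply: within_continuous_comp => // x _; exact: cdG.
  have iabs : mu.-integrable `[a, b] (EFin \o (fun t => `|df t|)).
    by have := integrable_norm idf.
  set I := Rintegral mu `[a, b] (fun t => dG (f t) * df t).
  set N := Rintegral mu `[a, b] (fun t => `|df t|).
  (* The bound is used at [e / (N + 1)]; the added 1 covers [N = 0]. *)
  suff bound : forall e, 0 < e -> G (f b) - G (f a) <= I + e * N.
    have N0 : 0 <= N by apply: Rintegral_ge0 => t _.
    apply/ler_addgt0Pr => e e0.
    apply: (le_trans (bound (e / (N + 1)) _)); first by rewrite divr_gt0// ltr_wpDl.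
    rewrite lerD2l mulrAC ler_pdivrMr ?ltr_wpDl//.
    by rewrite ler_pM2l// lerDl.
  move=> e e0.
  have ieabs : mu.-integrable `[a, b] (EFin \o (fun t => e * `|df t|)).
    exact: integrable_EFinZ.
  pose h t := dG (f t) * df t + e * `|df t|.
  have ih : mu.-integrable `[a, b] (EFin \o h).
    exact: (integrable_EFinD ig ieabs).
  have -> : I + e * N = Rintegral mu `[a, b] h.
    by rewrite RintegralD// RintegralZl.
  rewrite lerBlDr -lerBlDl.
  pose F t := G (f t) - Rintegral mu `[a, t] h.
  suff : F b <= F a.
    by rewrite /F set_itv1 Rintegral_set1 subr0.
  apply: le_locally_nonincreasing => // z zab.
  have e20 : 0 < e / 2 by rewrite divr_gt0.
  (* [eta] controls [dG] near [f z] up to [e / 2], and [d] keeps [f] within [eta] of [f z]. Two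
     values of [dG] in that ball then differ by at most [e]. *)
  have := cdG (f z); move/cvgrPdist_lt => /(_ _ e20) [eta /= eta0 etaP].
  have := cf; move/subspace_continuousP => /(_ z zab).
  move/cvgrPdist_lt => /(_ _ eta0) [d /= d0 dP].
  exists d => // s t as_ st tb zs zt.
  have near_f u : s <= u <= t -> `|f z - f u| < eta.
    move=> /andP[su ut]; apply: (dP u) => /=.
      move: zs zt; rewrite !ltr_distlC => /andP[zs sz] /andP[zt tz].
      by rewrite (lt_le_trans zs su) (le_lt_trans ut tz).
    by rewrite in_itv/= (le_trans as_ su) (le_trans ut tb).
  have [||c zc cE] := @mean_value_ball G dG (f z) eta (f s) (f t) GdG.
  - by apply: near_f; rewrite lexx st.
  - by apply: near_f; rewrite lexx st.
  rewrite /F lerBlDr addrAC -addrA -lerBlDl.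
  rewrite (Rintegral_subitv as_ st tb ih) cE (fE _ _ as_ st tb).
  have idf' := integrable_subitv as_ tb idf.
  rewrite -RintegralZl//; apply: le_Rintegral => //.
  - exact: integrable_EFinZ.
  - exact: integrable_subitv ih.
  move=> u /=; rewrite in_itv/= => sut.
  rewrite /h -lerBlDl -mulrBl (le_trans (ler_norm _))// normrM.
  rewrite ler_wpM2r//.
  have hc := etaP c zc.
  have hu := etaP _ (near_f u sut).
  rewrite (_ : dG c - dG (f u) = (dG (f z) - dG (f u)) - (dG (f z) - dG c)); last first.
    by ring.
  by rewrite (le_trans (ler_normB _ _))// (splitr e) lerD// ltW.
move=> ab GdG cdG fdf.
have cf := indefinite_integral_continuous ab fdf.
have ig : mu.-integrable `[a, b] (EFin \o (fun t => dG (f t) * df t)).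
  apply: integrableM_continuous; last by case: fdf.
  by apply: within_continuous_comp => // x _; exact: cdG.
split => // s t as_ st tb; have fst := indefinite_integralW as_ tb fdf.
apply/eqP; rewrite eq_le; apply/andP; split; first exact: (half s t G dG f df).
have dGN (z : R) : is_derive z (1 : R) (fun z => - G z) (- dG z) by exact: is_deriveN.
have cdGN : continuous (fun z => - dG z) by move=> z; apply: cvgN; exact: cdG.
have := half s t _ _ f df st dGN cdGN fst.
under eq_Rintegral do rewrite mulNr -mulN1r.
rewrite RintegralZl//; last exact: integrable_subitv ig.
by rewrite mulN1r -opprD lerN2.
Qed.

(* By polarization, 2 f g = (f + g)^2 - f^2 - g^2. *)
Lemma indefinite_integralM a b f df g dg : a <= b ->
  indefinite_integral a b f df -> indefinite_integral a b g dg ->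
  indefinite_integral a b (f \* g) (fun t => f t * dg t + df t * g t).
Proof.
move=> ab fdf gdg.
have sq u du : indefinite_integral a b u du ->
    indefinite_integral a b (fun t => u t * u t) (fun t => (u t + u t) * du t).
  apply: (@indefinite_integral_comp a b (fun z => z * z) (fun z => z + z)) => //.
  - move=> z.
    have := @is_deriveM _ _ id id z (1 : R) 1 1 (is_derive_id _ _) (is_derive_id _ _).
    by rewrite /= !scaler1.
  - by move=> z; apply: cvgD; exact: cvg_id.
have /(indefinite_integralZ (2^-1)) := sq _ _ (indefinite_integralD fdf gdg).
have /(indefinite_integralZ (- 2^-1)) := sq _ _ fdf.
have /(indefinite_integralZ (- 2^-1)) := sq _ _ gdg.
move=> h3 h2 h1.
have := indefinite_integralD (indefinite_integralD h1 h2) h3.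
by congr (indefinite_integral _ _ _ _); apply/funext => t /=; field.
Qed.

End IndefiniteIntegral.

(** * Derivatives of squared positive and negative parts, and of convex functions *)

Section Derivatives.
Context {R : realType}.
Implicit Types (f g : R -> R) (x y z t : R).

Lemma is_derive_quotientP f t df :
  is_derive t (1 : R) f df <-> (f (t + h) - f t) / h @[h --> 0^'] --> df.
Proof.
rewrite (_ : (fun h => (f (t + h) - f t) / h) =
  (fun h => h^-1 *: ((f \o shift t) (h *: (1 : R)) - f t))); last first.
  by apply/funext => h; rewrite /= [h *: 1]mulr1 mulrC (addrC h).
split=> [[dv <-]|dv]; first exact: dv.
by apply: DeriveDef; [apply/cvg_ex; exists df|exact: cvg_lim].
Qed.

(** The difference quotient misses df by at most C |h|. This treats the squared positive and
    negative parts at the kink 0 in the same way as elsewhere. *)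
Lemma is_derive_quadratic_error f t df (C : R) :
  (forall y, `|f y - f t - df * (y - t)| <= C * (y - t) ^+ 2) ->
  is_derive t (1 : R) f df.
Proof.
move=> fC; apply/is_derive_quotientP/cvgrPdist_le => e e0.
(* The bound at distance 1 from [t] shows that [C] dominates an absolute value. *)
have C0 : 0 <= C.
  by have := fC (t + 1); rewrite (_ : t + 1 - t = 1) ?expr1n ?mulr1; [apply: le_trans|ring].
near=> h.
have h0 : h != 0 by near: h; exact: nbhs_dnbhs_neq.
have := fC (t + h); rewrite (_ : t + h - t = h); last by ring.
move=> fh.
rewrite distrC (_ : _ - df = (f (t + h) - f t - df * h) / h); last by field.
rewrite normrM normfV ler_pdivrMr ?normr_gt0//.
apply: (le_trans fh); rewrite -[h ^+ 2]ger0_norm ?sqr_ge0// normrX expr2 mulrA.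
rewrite ler_wpM2r//.
apply: (@le_trans _ _ ((C + 1) * `|h|)); first by rewrite ler_wpM2r// lerDl.
rewrite mulrC -ler_pdivlMr ?ltr_wpDl//.
near: h; apply: dnbhs0_le; rewrite divr_gt0// ltr_wpDl//.
Unshelve. all: by end_near. Qed.

Lemma is_derive_sqr_max0 z :
  is_derive z (1 : R) (fun w => (Num.max w 0) ^+ 2 / 2) (Num.max z 0).
Proof.
apply: (@is_derive_quadratic_error _ _ _ 1) => y; rewrite ler_norml.
have := (sqr_ge0 y, sqr_ge0 z, sqr_ge0 (y - z)) => -[[y2 z2] yz2].
by case: (leP y 0) => y0; case: (leP z 0) => z0; apply/andP; split; nra.
Qed.

Lemma is_derive_sqr_min0 z :
  is_derive z (1 : R) (fun w => (Num.min w 0) ^+ 2 / 2) (Num.min z 0).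
Proof.
apply: (@is_derive_quadratic_error _ _ _ 1) => y; rewrite ler_norml.
have := (sqr_ge0 y, sqr_ge0 z, sqr_ge0 (y - z)) => -[[y2 z2] yz2].
by case: (leP y 0) => y0; case: (leP z 0) => z0; apply/andP; split; nra.
Qed.

(** By convexity (g (x + t (y - x)) - g x) / t <= g y - g x for 0 < t <= 1; let t tend to 0 from the
    right. *)
Lemma convex_tangent g dg x y : convex_function [set: R] g ->
  is_derive x (1 : R) g dg -> g x + dg * (y - x) <= g y.
Proof.
move=> cg /is_derive_quotientP gx.
have [->|yx] := eqVneq y x; first by rewrite subrr mulr0 addr0.
have yx0 : y - x != 0 by rewrite subr_eq0.
rewrite -lerBrDl.
(* Written as a difference quotient with increment [t * (y - x)], whose sign may be negative, so
   that the two-sided derivative at [x] applies. *)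
have cv : ((g (x + t * (y - x)) - g x) / (t * (y - x))) * (y - x) @[t --> 0^'+]
    --> dg * (y - x).
  apply: cvgM; last exact: cvg_cst.
  have tc : (t * (y - x)) @[t --> (0 : R)^'+] --> (0 : R)^'.
    move=> A [e /= e0 eA].
    have d0 : 0 < e / `|y - x| by rewrite divr_gt0 ?normr_gt0.
    exists (e / `|y - x|) => //= t; rewrite /ball_/= sub0r normrN => td t0.
    apply: eA; last by rewrite mulf_neq0// gt_eqF.
    by rewrite /= sub0r normrN normrM -ltr_pdivlMr ?normr_gt0.
  exact: (cvg_comp _ _ tc gx).
apply: (cvgr_to_le cv); near=> t.
have t0 : 0 < t by near: t; exact: nbhs_right_gt.
have t1 : t <= 1 by near: t; exact: nbhs_right_le.
have t01 : Itv.spec (Itv.num_sem (R:=R)) (Itv.Real `[0%Z, 1%Z]) t.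
  by rewrite /= /Itv.num_sem/= in_itv/= (ltW t0) t1 ger0_real// ltW.
have := cg (Itv.mk t01) y x (mem_setT _) (mem_setT _).
rewrite convRE /= [X in g X](_ : _ = x + t * (y - x)); last first.
  by transitivity (t * y + (1 - t) * x) => //; ring.
rewrite /unstable.onem => ct.
rewrite (_ : _ * (y - x) = (g (x + t * (y - x)) - g x) / t); last first.
  by field; rewrite yx0 gt_eqF.
by rewrite ler_pdivrMr//; lra.
Unshelve. all: by end_near. Qed.

(** Sum of the tangent inequalities at x and at y. *)
Lemma convex_derive_monotone g dg x y : convex_function [set: R] g ->
  (forall z, is_derive z (1 : R) g (dg z)) -> 0 <= (dg y - dg x) * (y - x).
Proof.
move=> cg gdg; have := convex_tangent y cg (gdg x).
have := convex_tangent x cg (gdg y); lra.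
Qed.

(* dg y lies between the slopes of the chords from y to z - h and to z + h, which
   depend continuously on y. *)
Lemma convex_derive_continuous g dg : convex_function [set: R] g ->
  (forall z, is_derive z (1 : R) g (dg z)) -> continuous dg.
Proof.
move=> cg gdg z; apply/cvgrPdist_le => e e0.
have e20 : 0 < e / 2 by rewrite divr_gt0.
have /is_derive_quotientP/cvgrPdist_lt/(_ _ e20) [d /= d0 dP] := gdg z.
(* Half of [d] puts [z + h] and [z - h] strictly inside the ball where chord slopes at [z] are
   within [e / 2] of [dg z]; moving [y] towards [z] costs another [e / 2]. *)
pose h := d / 2.
have h0 : 0 < h by rewrite divr_gt0.
have hd : h < d by rewrite ltr_pdivrMr// ltr_pMr// ltr1n.
have cg_ : continuous g.
  by move=> w; apply/differentiable_continuous/derivable1_diffP; case: (gdg w).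
have cslope w : w != z -> (g w - g y) / (w - y) @[y --> z] --> (g w - g z) / (w - z).
  move=> wz; apply: cvgM.
    by apply: cvgB; [exact: cvg_cst|exact: cg_].
  apply: cvgV; first by rewrite subr_eq0.
  by apply: cvgB; [exact: cvg_cst|exact: cvg_id].
have hP : `|dg z - (g (z + h) - g z) / h| < e / 2.
  by apply: dP => /=; rewrite ?gt_eqF// sub0r normrN gtr0_norm.
have hN : `|dg z - (g (z - h) - g z) / (- h)| < e / 2.
  by apply: dP => /=; rewrite ?oppr_eq0 ?gt_eqF// sub0r opprK gtr0_norm.
have zhP : z + h != z by rewrite -subr_eq0 addrAC subrr add0r gt_eqF.
have zhN : z - h != z by rewrite -subr_eq0 addrAC subrr add0r oppr_eq0 gt_eqF.
have /cvgrPdist_lt/(_ _ e20) sP := cslope _ zhP.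
have /cvgrPdist_lt/(_ _ e20) sN := cslope _ zhN.
near=> y.
have yz : `|z - y| < h by near: y; exists h.
move: yz; rewrite ltr_distlC => /andP[zy yz].
have : `|(g (z + h) - g z) / (z + h - z) - (g (z + h) - g y) / (z + h - y)| < e / 2.
  by near: y.
have : `|(g (z - h) - g z) / (z - h - z) - (g (z - h) - g y) / (z - h - y)| < e / 2.
  by near: y.
rewrite [z + h - z]addrAC [z - h - z]addrAC !subrr !add0r.
have tP : dg y <= (g (z + h) - g y) / (z + h - y).
  rewrite ler_pdivlMr; last by lra.
  by have := convex_tangent (z + h) cg (gdg y); lra.
have tN : (g (z - h) - g y) / (z - h - y) <= dg y.
  rewrite ler_ndivrMr; last by lra.
  by have := convex_tangent (z - h) cg (gdg y); lra.
move: hP hN; rewrite !ltr_norml ler_norml.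
by move=> /andP[? ?] /andP[? ?] /andP[? ?] /andP[? ?]; apply/andP; split; lra.
Unshelve. all: by end_near. Qed.

End Derivatives.

(** * Storage increment of a single projected multiplier *)

Section StorageIncrement.
Context {R : realType}.
Local Notation mu := (@lebesgue_measure R).
Implicit Types (a b s t : R) (h dh th dth : R -> R).

Let psi (n : nat) (z : R) : R := 1 - expR (- (n%:R * z)).

Let is_derive_psi n z : is_derive z (1 : R) (psi n) (n%:R * expR (- (n%:R * z))).
Proof.
have lin : is_derive z (1 : R) (fun w => - n%:R * w) (- n%:R).
  have := @is_deriveZ _ _ _ id (- n%:R) z (1 : R) 1 (is_derive_id _ _).
  by rewrite [_ *: 1]mulr1.
have := is_derive1_comp (is_derive_expR (- n%:R * z)) lin.
move=> /(is_deriveB (is_derive_cst (1 : R) z 1)).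
rewrite sub0r mulrN opprK mulNr mulrC.
rewrite (_ : cst 1 - (expR \o _) = psi n)//.
by apply/funext => w; rewrite /psi -mulNr.
Qed.

Let psi_ge0_le1 n z : 0 <= z -> 0 <= psi n z <= 1.
Proof.
move=> z0; rewrite /psi subr_ge0 -[X in _ <= X]expR0 ler_expR oppr_le0.
by rewrite mulr_ge0//= lerBlDr lerDl expR_ge0.
Qed.

Let cvg_psi z : 0 <= z -> psi n z @[n --> \oo] --> ((0 < z)%R%:R : R).
Proof.
rewrite le_eqVlt => /predU1P[<-|z0].
  rewrite ltxx (_ : psi ^~ 0 = cst 0); first exact: cvg_cst.
  by apply/funext => n; rewrite /psi mulr0 oppr0 expR0 subrr.
rewrite z0 -[X in _ --> X]subr0; apply: cvgB; first exact: cvg_cst.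
(* For [z > 0] this is a geometric sequence of ratio [expR (- z) < 1]. *)
rewrite (_ : (fun n => _) = GRing.exp (expR (- z))); last first.
  by apply/funext => n; rewrite -mulrN expRM_natl.
apply: cvg_expr; rewrite ger0_norm ?expR_ge0//.
by rewrite -[X in _ < X]expR0 ltr_expR oppr_lt0.
Qed.

(** The energy inequality for one constraint, with h = g_j(x_ik) and th its multiplier. The
    projected rate dth may jump, so the inequality is first proved for a smoothed storage and then
    passed to the limit. *)
Lemma integral_projected_rate a b h dh th dth : a <= b ->
  indefinite_integral a b h dh -> indefinite_integral a b th dth ->
  (forall t, a <= t <= b -> 0 <= th t) ->
  (forall t, a <= t <= b ->
    dth t = if (th t == 0) && (h t <= 0) then 0 else h t) ->
  mu.-integrable `[a, b] (EFin \o (fun t => dth t * dh t)) /\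
  dth b ^+ 2 / 2 - dth a ^+ 2 / 2 <= Rintegral mu `[a, b] (fun t => dth t * dh t).
Proof.
move=> ab hdh thdth th0 dthE.
pose p t := Num.max (h t) 0.
pose r t := Num.min (h t) 0.
have aab : a <= a <= b by rewrite lexx ab.
have bab : a <= b <= b by rewrite lexx ab.
have dthpr t : a <= t <= b -> dth t = p t + r t * (0 < th t)%R%:R.
  move=> tab; rewrite dthE// lt0r th0// andbT /p /r.
  case: eqP => /= _; last by rewrite mulr1; case: (leP (h t) 0); rewrite ?addr0 ?add0r.
  by rewrite mulr0 addr0; case: (leP (h t) 0).
have ich := indefinite_integral_continuous ab hdh.
have icth := indefinite_integral_continuous ab thdth.
have iP : indefinite_integral a b (fun t => p t ^+ 2 / 2) (fun t => p t * dh t).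
  have cmax0 : continuous (fun z : R => Num.max z 0).
    by move=> z; apply: (@continuous_max _ R id (cst 0)) => //; exact: cvg_cst.
  exact: (indefinite_integral_comp ab is_derive_sqr_max0 cmax0 hdh).
have iQ : indefinite_integral a b (fun t => r t ^+ 2 / 2) (fun t => r t * dh t).
  have cmin0 : continuous (fun z : R => Num.min z 0).
    by move=> z; apply: (@continuous_min _ R id (cst 0)) => //; exact: cvg_cst.
  exact: (indefinite_integral_comp ab is_derive_sqr_min0 cmin0 hdh).
have cpsi n : continuous (psi n).
  move=> z; apply/differentiable_continuous/derivable1_diffP.
  by case: (is_derive_psi n z).
have cdpsi n : continuous (fun z : R => n%:R * expR (- (n%:R * z))).
  move=> z; apply: cvgM; first exact: cvg_cst.
  apply: continuous_comp; last exact: continuous_expR.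
  by apply: cvgN; apply: cvgM; [exact: cvg_cst|exact: cvg_id].
have ipsi n : indefinite_integral a b (psi n \o th)
    (fun t => n%:R * expR (- (n%:R * th t)) * dth t).
  exact: (indefinite_integral_comp ab (is_derive_psi n) (@cdpsi n) thdth).
(* [F n] is the smoothed supply rate; [W n] below is the smoothed storage. *)
pose F n t := (p t + r t * psi n (th t)) * dh t.
have iF n : mu.-integrable `[a, b] (EFin \o F n).
  rewrite (_ : F n = (fun t => p t * dh t) \+
      (fun t => (psi n \o th) t * (r t * dh t))).
    apply: integrable_EFinD; first by case: iP.
    apply: integrableM_continuous; last by case: iQ.
    by apply: within_continuous_comp => // x _; exact: cpsi.
  by apply/funext => t; rewrite /F/=; ring.
pose W n t := p t ^+ 2 / 2 + r t ^+ 2 / 2 * psi n (th t).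
have WF n : W n b - W n a <= Rintegral mu `[a, b] (F n).
  have [idW WE] := indefinite_integralD iP (indefinite_integralM ab iQ (ipsi n)).
  rewrite [leLHS](WE _ _ (lexx a) ab (lexx b)); apply: le_Rintegral => //.
    exact: iF.
  move=> t; rewrite /= in_itv/= => tab.
  (* The derivative of [W n] exceeds [F n] by exactly [r t ^+ 2 / 2 * (n%:R * expR (- (n%:R * th
     t))) * dth t]. Where [r t] is nonzero, [h t < 0], and [dth t] is then [0] or [h t]. *)
  suff : r t ^+ 2 * dth t <= 0.
    move=> /mulr_le0_ge0/(_ (mulr_ge0 (ler0n R n) (expR_ge0 (- (n%:R * th t))))).
    by rewrite /F/=; lra.
  rewrite dthE//; case: ifPn => [_|_]; first by rewrite mulr0.
  rewrite /r; case: (leP (h t) 0) => ht; last by rewrite expr0n mul0r.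
  by rewrite mulr_ge0_le0// sqr_ge0.
have cF t : a <= t <= b -> F n t @[n --> \oo] --> dth t * dh t.
  move=> tab; apply: cvgM; last exact: cvg_cst.
  rewrite dthpr//; apply: cvgD; first exact: cvg_cst.
  by apply: cvgM; [exact: cvg_cst|exact/cvg_psi/th0].
have cW t : a <= t <= b -> W n t @[n --> \oo] --> dth t ^+ 2 / 2.
  move=> tab.
  rewrite (_ : dth t ^+ 2 / 2 = p t ^+ 2 / 2 + r t ^+ 2 / 2 * (0 < th t)%R%:R).
    apply: cvgD; first exact: cvg_cst.
    by apply: cvgM; [exact: cvg_cst|exact/cvg_psi/th0].
  (* The cross term in the square vanishes because [p t * r t = 0], and an indicator equals its own
     square. *)
  rewrite dthpr// /p /r; case: (0 < th t); case: (leP (h t) 0) => _ /=; lra.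
have mdth : measurable_fun `[a, b] dth.
  by case: thdth => /integrableP[/measurable_EFinP].
have mdh : measurable_fun `[a, b] dh.
  by case: hdh => /integrableP[/measurable_EFinP].
have ihdh : mu.-integrable `[a, b] (EFin \o (fun t => `|h t * dh t|)).
  by have := integrable_norm (integrableM_continuous ich hdh.1).
(* A majorant independent of [n]: at most one of [p t], [r t] is nonzero, and [psi n] lies in [0, 1]
   on nonnegative arguments. *)
have FM n t : a <= t <= b -> `|F n t| <= `|h t * dh t|.
  move=> tab; rewrite /F !normrM ler_wpM2r//.
  have /andP[] := psi_ge0_le1 n (th0 _ tab); move: (psi n _) => c c0 c1.
  rewrite /p /r; case: (leP (h t) 0) => ht.
    by rewrite add0r normrM ler_piMr// ger0_norm.
  by rewrite mul0r addr0.
have mdthdh : measurable_fun `[a, b] (EFin \o (fun t => dth t * dh t)).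
  by apply/measurable_EFinP; exact: measurable_funM.
have aecF : {ae mu, forall t, `[a, b]%classic t ->
    (EFin \o F n) t @[n --> \oo] --> (EFin \o (fun t => dth t * dh t)) t}.
  apply: aeW => t /=; rewrite in_itv/= => tab.
  by apply: cvg_EFin; [exact: nearW|exact: cF].
have aeFM : {ae mu, forall t n, `[a, b]%classic t ->
    (`|(EFin \o F n) t| <= (EFin \o (fun t => (`|h t * dh t|)%R)) t)%E}.
  apply: aeW => t n /=; rewrite in_itv/= => tab.
  by rewrite lee_fin; exact: FM.
have mF n : measurable_fun `[a, b] (EFin \o F n) := measurable_int mu (iF n).
have [//|idd _ cI] := @dominated_convergence _ _ _ mu `[a, b] _ _ _ _
  mF mdthdh aecF ihdh aeFM.
split => //.
(* Pointwise convergence at the two end points is enough here, so jumps of [dth] in between do no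
   harm. *)
have cWab : W n b - W n a @[n --> \oo] --> dth b ^+ 2 / 2 - dth a ^+ 2 / 2.
  by apply: cvgB; exact: cW.
have cIF : Rintegral mu `[a, b] (F n) @[n --> \oo] -->
    Rintegral mu `[a, b] (fun t => dth t * dh t).
  by apply: fine_cvg; rewrite fineK; [exact: cI|exact: integrable_fin_num].
by apply: (ler_cvg_to cWab cIF); exact: nearW.
Qed.

End StorageIncrement.

(** * Comparison of integrals and the pointwise power inequality *)

Section PassivityTools.
Context {R : realType}.
Local Notation mu := (@lebesgue_measure R).

(* Positive part minus negative part is monotone in [\bar R] even when it reads
   [+oo - +oo], which is [-oo]. *)
Lemma ae_le_integral d (T : measurableType d) (nu : {measure set T -> \bar R})
    (D : set T) (f1 f2 : T -> \bar R) :
  measurable D -> measurable_fun D f1 -> measurable_fun D f2 ->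
  {ae nu, forall t, D t -> (f1 t <= f2 t)%E} ->
  (\int[nu]_(t in D) f1 t <= \int[nu]_(t in D) f2 t)%E.
Proof.
move=> mD mf1 mf2 f12; rewrite integralE [leRHS]integralE leeB//.
- apply: ae_ge0_le_integral => //; [exact: measurable_funepos..|].
  apply: filterS f12 => t f12 Dt; rewrite !funeposE ge_max le_max f12//=.
  by rewrite le_max lexx orbT.
- apply: ae_ge0_le_integral => //; [exact: measurable_funeneg..|].
  apply: filterS f12 => t f12 Dt; rewrite !funenegE ge_max le_max leeN2 f12//=.
  by rewrite le_max lexx orbT.
Qed.

Lemma Rintegral_sum (a b : R) (I : finType) (F : I -> R -> R) :
  (forall i, mu.-integrable `[a, b] (EFin \o F i)) ->
  mu.-integrable `[a, b] (EFin \o (fun t => \sum_i F i t)) /\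
  Rintegral mu `[a, b] (fun t => \sum_i F i t) = \sum_i Rintegral mu `[a, b] (F i).
Proof.
move=> iF.
have E : EFin \o (fun t => \sum_i F i t) = (fun t => (\sum_i (EFin \o F i) t)%E).
  by apply/funext => t; rewrite /= sumEFin.
have iS : mu.-integrable `[a, b] (EFin \o (fun t => \sum_i F i t)).
  by rewrite E; apply: integrable_sum.
split=> //; apply: EFin_inj.
rewrite fineK; last exact: integrable_fin_num iS.
under eq_integral do rewrite -sumEFin.
rewrite (integral_sum _ iF)//.
rewrite -sumEFin; apply: eq_bigr => i _; rewrite fineK//.
exact: (integrable_fin_num _ (iF i)).
Qed.

(** Difference quotients are used because dG_j(x) need not have a derivative at t. Splitting the
    increment of th_j dG_j(x) as (increment of th_j) dG_j(x(t + h)) + th_j(t) (increment of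
    dG_j(x)), the second part times the increment of x is nonnegative by monotonicity. *)
Lemma multiplier_output_power_ge (m : nat) (dG : 'I_m -> R -> R)
    (th : 'I_m -> R -> R) (x y : R -> R) (t dx dy : R) (dth : 'I_m -> R) :
  (forall j u v, 0 <= (dG j v - dG j u) * (v - u)) ->
  (forall j, continuous (dG j)) -> (forall j, 0 <= th j t) ->
  (forall s, y s = \sum_(j < m) th j s * dG j (x s)) ->
  is_derive t (1 : R) x dx -> is_derive t (1 : R) y dy ->
  (forall j, is_derive t (1 : R) (th j) (dth j)) ->
  \sum_(j < m) dth j * (dG j (x t) * dx) <= dy * dx.
Proof.
move=> dGmono cdG th0 yE dxP dyP dthP.
have cx : x (t + h) @[h --> 0^'] --> x t.
  have ctx : {for t, continuous x}.
    by apply/differentiable_continuous/derivable1_diffP; case: dxP.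
  have cth : t + h @[h --> (0 : R)^'] --> t.
    have : t + h @[h --> (0 : R)] --> t + 0.
      by apply: cvgD; [exact: cvg_cst|exact: cvg_id].
    by rewrite addr0 => /cvg_within_filter; exact.
  exact: (cvg_comp _ _ cth ctx).
move/is_derive_quotientP : dxP => dxP; move/is_derive_quotientP : dyP => dyP.
have cvl : (\sum_(j < m) (th j (t + h) - th j t) / h *
    (dG j (x (t + h)) * ((x (t + h) - x t) / h))) @[h --> 0^'] -->
    \sum_(j < m) dth j * (dG j (x t) * dx).
  apply: cvg_big => [|j _]; first exact: add_continuous.
  move/is_derive_quotientP : (dthP j) => djP.
  apply: (cvgM djP); apply: cvgM; last exact: dxP.
  exact: (cvg_comp _ _ cx (cdG j (x t))).
have cvr : ((y (t + h) - y t) / h * ((x (t + h) - x t) / h)) @[h --> 0^'] --> dy * dx.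
  by apply: cvgM.
apply: (ler_cvg_to cvl cvr); near=> h.
have h0 : h != 0 by near: h; exact: nbhs_dnbhs_neq.
rewrite -subr_ge0 !yE -sumrB !mulr_suml -sumrB sumr_ge0// => j _.
rewrite (_ : _ - _ = th j t *
  ((dG j (x (t + h)) - dG j (x t)) * (x (t + h) - x t)) / h ^+ 2); last by field.
by rewrite divr_ge0 ?sqr_ge0// mulr_ge0.
Unshelve. all: by end_near. Qed.

Lemma ac_derivative_indefinite_integral (a b : R) (f df : R -> R) : 0 <= a ->
  ac_derivative f df -> indefinite_integral a b f df.
Proof.
move=> a0 [_ idf fE]; split.
  have [b0|b0] := leP 0 b; first exact: integrable_subitv (idf _ b0).
  (* For [b < 0 <= a] the segment is empty. *)
  by rewrite set_itv_ge ?integrable_set0// bnd_simp -ltNge (lt_le_trans b0).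
by move=> s t as_ st tb; apply: fE; rewrite (le_trans a0 as_).
Qed.

End PassivityTools.

(** * Passivity of the subsystem *)

Theorem proposition2p3 (R : realType) (n l : nat) (m : 'I_n -> 'I_l -> nat)
    (g : nat -> R -> R)
    (g_convex : forall (i : 'I_n) (k : 'I_l) (j : 'I_(m i k)),
      convex_function [set: R] (g j))
    (g_diff : forall (i : 'I_n) (k : 'I_l) (j : 'I_(m i k)) (z : R),
      derivable (g j) z (1 : R))
    (x dx dy : R -> 'M[R]_(n, l))
    (theta dtheta : forall (i : 'I_n) (k : 'I_l), 'I_(m i k) -> R -> R)
    (x_ac : forall (i : 'I_n) (k : 'I_l),
      ac_derivative (fun t => x t i k) (fun t => dx t i k))
    (H3 : H3_trajectory g x theta dtheta)
    (y_diff : forall (i : 'I_n) (k : 'I_l),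
      ae_derivative (fun t => H3_output g x theta t i k) (fun t => dy t i k))
    (i : 'I_n) (sigma : {set constraint m i}) (tau_m tau_p : R)
    (tau_m_ge0 : 0 <= tau_m) (tau_lt : tau_m < tau_p)
    (sigma_p : switching_signal g x theta i tau_p = sigma)
    (sigma_m : switching_signal g x theta i tau_m = sigma)
    (sigma_between : forall t : R, tau_m < t < tau_p ->
      switching_signal g x theta i t <> sigma) :
  passive_between (H3_storage g x theta dtheta) dx dy tau_m tau_p.
Proof.
set mu := @lebesgue_measure R.
have tau_le := ltW tau_lt.
have g_derive i' k (j : 'I_(m i' k)) z : is_derive z (1 : R) (g j) (derive1 (g j) z).
  by rewrite derive1E; apply: DeriveDef => //; exact: (@g_diff i' k j).
(* Chain-rule derivative of [g j] along [x]; [derive1 (g j)] is continuous by convexity, as the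
   chain rule requires. *)
pose dh i' k (j : 'I_(m i' k)) t := derive1 (g j) (x t i' k) * dx t i' k.
have rate i' k (j : 'I_(m i' k)) t : 0 <= t -> dtheta i' k j t =
    if (theta i' k j t == 0) && (g j (x t i' k) <= 0) then 0 else g j (x t i' k).
  by have [_ _ dthE] := H3 i' k j => t0; rewrite dthE// inE.
have increment i' k (j : 'I_(m i' k)) :
    mu.-integrable `[tau_m, tau_p] (EFin \o (fun t => dtheta i' k j t * dh i' k j t)) /\
    dtheta i' k j tau_p ^+ 2 / 2 - dtheta i' k j tau_m ^+ 2 / 2 <=
    Rintegral mu `[tau_m, tau_p] (fun t => dtheta i' k j t * dh i' k j t).
  have [th0 th_ac _] := H3 i' k j.
  have cdg := convex_derive_continuous (@g_convex i' k j) (@g_derive i' k j).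
  have ix := ac_derivative_indefinite_integral tau_p tau_m_ge0 (x_ac i' k).
  have ith := ac_derivative_indefinite_integral tau_p tau_m_ge0 th_ac.
  apply: (integral_projected_rate tau_le
    (indefinite_integral_comp tau_le (@g_derive i' k j) cdg ix) ith) => t /andP[tt _].
    by apply: th0; exact: le_trans tt.
  by apply: rate; exact: le_trans tt.
(* The sum extends to all constraints, since the rate vanishes where the projection is active. The
   index set then no longer depends on time. *)
have storageE t : 0 <= t -> H3_storage g x theta dtheta t =
    \sum_(i' < n) \sum_(k < l) \sum_(j < m i' k) dtheta i' k j t ^+ 2 / 2.
  move=> t0; rewrite /H3_storage mulr_sumr; apply: eq_bigr => i' _.
  rewrite mulr_sumr; apply: eq_bigr => k _.
  rewrite mulr_sumr big_mkcond; apply: eq_bigr => j _.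
  rewrite mulrC; case: ifPn => // /negPn cin.
  by have [_ _ ->] := H3 i' k j; rewrite // cin expr0n mul0r.
have S1 i' k := Rintegral_sum (fun j => (increment i' k j).1).
have S2 i' := Rintegral_sum (fun k => (S1 i' k).1).
have [S3i S3] := Rintegral_sum (fun i' => (S2 i').1).
rewrite /passive_between.
(* The intermediate quantity is finite: it dominates the storage increment constraint by constraint,
   and its integrand is almost everywhere below the supplied power. *)
apply: (@le_trans _ _ (\int[mu]_(t in `[tau_m, tau_p])
  (\sum_(i' < n) \sum_(k < l) \sum_(j < m i' k)
     dtheta i' k j t * dh i' k j t)%:E)%E).
  rewrite -[leRHS]fineK; last exact: integrable_fin_num S3i.
  rewrite lee_fin [leRHS]S3 !storageE//; last exact: le_trans tau_le.
  rewrite -sumrB; apply: ler_sum => i' _; rewrite (S2 i').2.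
  rewrite -sumrB; apply: ler_sum => k _; rewrite (S1 i' k).2.
  by rewrite -sumrB; apply: ler_sum => j _; exact: (increment i' k j).2.
apply: ae_le_integral.
- exact: measurable_itv.
- exact: measurable_int S3i.
- apply/measurable_EFinP; apply: measurable_sum => i'.
  apply: measurable_sum => k; apply: measurable_funM.
    have [mdy _] := y_diff i' k; apply: measurable_funS mdy => //.
    by apply: subset_itv; rewrite bnd_simp.
  have [[mdx _] _ _] := x_ac i' k; apply: measurable_funS mdx => //.
  by apply: subset_itv; rewrite bnd_simp.
(* Almost-everywhere derivatives are given only at positive times, so the left end point is
   discarded in case it is [0]. *)
have tau0 : {ae mu, forall t : R, t != tau_m}.
  exists [set tau_m]; split; [exact: measurable_set1|exact: lebesgue_measure_set1|].
  by move=> t /= /negP; rewrite negbK => /eqP.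
have aeik i' k : {ae mu, forall t : R, 0 < t ->
    \sum_(j < m i' k) dtheta i' k j t * dh i' k j t <= dy t i' k * dx t i' k}.
  have [_ aey] := y_diff i' k.
  have [[_ aex] _ _] := x_ac i' k.
  (* Finitely many exceptional null sets are merged, so that one time [t] serves all constraints at
     once. *)
  have aeth : {ae mu, forall t : R, forall j : 'I_(m i' k),
      0 < t -> is_derive t (1 : R) (theta i' k j) (dtheta i' k j t)}.
    by apply: filter_forall => j; have [_ [[]]] := H3 i' k j.
  apply: (@filterS3 _ (almost_everywhere mu)) aey aex aeth => t ty tx tth t0.
  apply: (@multiplier_output_power_ge _ _ (fun j => derive1 (g j)) (theta i' k)
    (fun s => x s i' k) (fun s => H3_output g x theta s i' k)).
  - by move=> j u v; exact: (convex_derive_monotone _ _ (@g_convex i' k j) (@g_derive i' k j)).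
  - by move=> j; exact: (convex_derive_continuous (@g_convex i' k j) (@g_derive i' k j)).
  - by move=> j; have [th0 _ _] := H3 i' k j; exact/th0/ltW.
  - by move=> s; rewrite /H3_output mxE.
  - exact: tx.
  - exact: ty.
  - by move=> j; exact: tth.
have aeall : {ae mu, forall t : R, forall i' k, 0 < t ->
    \sum_(j < m i' k) dtheta i' k j t * dh i' k j t <= dy t i' k * dx t i' k}.
  by apply: filter_forall => i'; apply: filter_forall => k; exact: aeik.
apply: (@filterS2 _ (almost_everywhere mu)) tau0 aeall => t tt0 tall; rewrite /= in_itv/= => /andP[tt _].
rewrite lee_fin; apply: ler_sum => i' _; apply: ler_sum => k _; apply: tall.
by apply: (le_lt_trans tau_m_ge0); rewrite lt_neqAle eq_sym tt0.
Qed.
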